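(* Let $p$ be a prime with $p\equiv 1\pmod 4$ and let $m,\alpha,\beta\ge 1$ be integers with $2\nmid\alpha$. (i) If $\bar a_{2^m\alpha}(3p)\equiv 0\pmod 2$, then for all integers $n,k\ge 0$ with $p\nmid(4n+3)$, $$\bar a_{2^m\alpha}\left(4p^{2k+1}n+3p^{2k+1}\right)\equiv 0\pmod{2^{m+3}}.$$ (ii) If $\bar a_{2\beta+1}(3p)\equiv 0\pmod 2$, then for all integers $n,k\ge 0$ with $p\nmid(4n+3)$, $$\bar a_{2\beta+1}\left(4p^{2k+1}n+3p^{2k+1}\right)\equiv 0\pmod{16}.$$
   Context: For integers $\ell\ge1$ write $f_\ell=\prod_{j\ge 1}(1-q^{\ell j})$. For a positive integer $s$, $\bar a_s(n)$ denotes the number of partitions of $n$ in which each odd part occurs in one of $s$ colors and the first occurrence of each part (parts of the same size but different colors being distinct) may be overlined. Equivalently, $$\sum_{n\ge0}\bar a_s(n)q^n=\frac{f_2^{3s-2}}{f_1^{2s}f_4^{s-1}}.$$ *)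

(* Defs.v *)
From mathcomp Require Import all_boot.

Set Implicit Arguments.
Unset Strict Implicit.
Unset Printing Implicit Defensive.

Definition ncolors (s j : nat) : nat := if odd j then s else 1.

(* The element of part s n with tag j : 'I_n stands for a part of size j.+1,
   so the sizes are 1, ..., n; the second component is its color. *)
Definition part (s n : nat) : finType := {j : 'I_n & 'I_(ncolors s j.+1)}.

Definition part_size (s n : nat) (x : part s n) : nat := (tag x).+1.

(* A partition of n is given by the multiplicity of each colored part (at most
   n, since sizes are positive) together with the set of colored parts whose
   first occurrence is overlined; only parts that occur can be overlined. *)
Definition is_colored_overpartition (s n : nat)
    (P : {ffun part s n -> 'I_n.+1} * {set part s n}) : bool :=
  (\sum_(x : part s n) P.1 x * part_size x == n) &&
  (P.2 \subset [set x | 0 < P.1 x]).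

Definition abar (s n : nat) : nat :=
  #|[set P | @is_colored_overpartition s n P]|.

(* Main.v *)
(* Write phi(x) = 1 + 2 (x + x^4 + x^9 + ...) and psi(x) = sum_t x^(t(t+1)).
   Gauss's identity phi(-x) prod_j (1 + x^j) / (1 - x^j) = 1, applied twice, turns
   the generating function of abar s into
     phi(x)^s phi(x^2)^(s+1) P(x^4)^(2(s+1)),  P(x) = prod_j (1 + x^j) / (1 - x^j).
   Substituting phi(x) = phi(x^4) + 2 x psi(x^4) and expanding binomially, only two
   terms with exponent 3 mod 4 survive modulo 2^(m+3), resp. 16, and each of them is
   divisible by half the modulus.  Since phi = P = 1 and psi(x)^2 = psi(x^2) modulo 2,
   the coefficient left at 4M+3 is, modulo 2, that of x^M in psi(x) psi(x^2), namely
   the number of (a, b) with a, b > 0 odd and a^2 + 2 b^2 = 4M+3.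

   That number is even when 4M+3 = p^(2k+1) (4n+3) with p not dividing 4n+3.  It is 0
   if 4M+3 = 7 mod 8.  Otherwise involutions on {x^2 + 2yz = 4M+3, y, z > 0}, in the
   style of Heath-Brown and Zagier, show that it has the parity of the number of
   divisor pairs d e = 4M+3, d < e, which is d(p^(2k+1)) d(4n+3) / 2; both factors
   are even because neither argument is a square. *)
Require Import Defs.
From mathcomp Require Import all_boot all_order all_algebra zify ring.
Import Order.TTheory GRing.Theory Num.Theory.

Set Implicit Arguments.
Unset Strict Implicit.
Unset Printing Implicit Defensive.

(** * Gauss's identity and the colored product at a nilpotent argument *)

Section Overpartitions.
Local Open Scope ring_scope.

(* Shanks's finite form of Gauss's identity; passing from n to n+1 changes the
   summands on the right by the telescoping differences G s.+1 - G s below. *)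
Lemma gauss_finite (R : comNzRingType) (q : R) (n : nat) :
  (1 + (\sum_(1 <= k < n.+1) (-1) ^+ k * q ^+ (k ^ 2)) *+ 2) *
    \prod_(1 <= j < n.+1) (1 + q ^+ j) =
  \sum_(0 <= s < n.+1) (-1) ^+ s * q ^+ (s * n.+1) *
    (\prod_(0 <= j < s) (1 + q ^+ j)) * \prod_(s.+1 <= j < n.+1) (1 - q ^+ j).
Proof.
elim: n => [|n IHn].
  by rewrite big_nat1 !big_geq // expr0 !mulr1 mul0rn addr0.
rewrite big_nat_recr //= mulrnDl addrA mulrDl.
rewrite [X in _ * X + _]big_nat_recr //= mulrA IHn mulr_suml.
pose A s : R := \prod_(0 <= j < s) (1 + q ^+ j).
pose B s m : R := \prod_(s.+1 <= j < m.+1) (1 - q ^+ j).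
pose G s : R := - ((-1) ^+ s * q ^+ (s * n.+1) * A s *
  \prod_(s <= j < n.+1) (1 - q ^+ j)).
have AS s : A s.+1 = A s * (1 + q ^+ s) by rewrite /A big_nat_recr.
(* The factor of [A] at j = 0 is 1 + q^0 = 2 and absorbs the doubling of the new theta term. *)
have A2 : (\prod_(1 <= j < n.+2) (1 + q ^+ j)) *+ 2 = A n.+1 * (1 + q ^+ n.+1).
  by rewrite -AS /A [RHS]big_ltn // expr0 -[1 + 1]/(2%:R) mulr_natl.
rewrite mulrnAl -mulrnAr A2 [RHS]big_nat_recr //=.
(* [G] vanishes at 0 because of its factor 1 - q^0. *)
have E : \sum_(0 <= s < n.+1) (G s.+1 - G s) = G n.+1.
  rewrite telescope_sumr // [X in _ - X](_ : _ = 0) ?subr0 //.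
  by rewrite /G [\prod_(0 <= j < n.+1) (1 - _)]big_ltn // subrr mul0r mulr0 oppr0.
transitivity (\sum_(0 <= s < n.+1) ((-1) ^+ s * q ^+ (s * n.+1) * A s * B s n * (1 + q ^+ n.+1)
   - (G s.+1 - G s)) + ((-1) ^+ n.+1 * q ^+ (n.+1 * n.+2) * A n.+1)).
  rewrite sumrB E -addrA; congr (_ + _).
  rewrite /G big_geq // !mulr1 opprK (mulnSr _ n.+1) exprD -mulnn.
  ring.
congr (_ + _); last by rewrite [X in _ = _ * X]big_geq // mulr1.
apply: eq_big_nat => s /andP[_ ltsn].
rewrite /G [in X in _ - X]AS /B -/(A s) -/(A s.+1).
rewrite [\prod_(s <= j < n.+1) _]big_ltn // [\prod_(s.+1 <= j < n.+2) _]big_nat_recr //.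
set b := \prod_(s.+1 <= j < _) _.
rewrite (mulnSr s n.+1) (mulSn s n.+1) !exprD (exprS (-1) s).
by rewrite /=; ring.
Qed.

(* When y^(N+1) = 0 this is (1 + y) / (1 - y). *)
Definition overgeo (R : comNzRingType) (N : nat) (y : R) : R :=
  \sum_(i < N.+1) y ^+ i *+ 2 ^ (0 < i).

Definition overprod (R : comNzRingType) (N : nat) (x : R) : R :=
  \prod_(1 <= j < N.+1) overgeo N (x ^+ j).

(* theta and psi truncate the phi and psi above, which is harmless modulo x^(N+1). *)
Definition theta (R : comNzRingType) (N : nat) (x : R) : R :=
  1 + (\sum_(1 <= k < N.+1) x ^+ (k ^ 2)) *+ 2.

Section Nilpotent.
Variables (R : comNzRingType) (N : nat).
Implicit Types x y : R.

Lemma sub1_unit_nilp y : y ^+ N.+1 = 0 ->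
  (1 - y) * (\sum_(i < N.+1) y ^+ i) = 1.
Proof. by move=> y0; rewrite -opprB mulNr -subrX1 y0 sub0r opprK. Qed.

Lemma overgeo_mul y : y ^+ N.+1 = 0 -> (1 - y) * overgeo N y = 1 + y.
Proof.
move=> y0; suff -> : overgeo N y = (\sum_(i < N.+1) y ^+ i) *+ 2 - 1.
  by rewrite mulrBr mulr1 mulrnAr sub1_unit_nilp //; ring.
rewrite /overgeo !big_ord_recl expr0 mulrnDl -addrA addrCA addrC.
by rewrite -sumrMnl mulr2n; ring.
Qed.

Lemma expr_nilp y (k : nat) : y ^+ N.+1 = 0 -> (0 < k)%N -> (y ^+ k) ^+ N.+1 = 0.
Proof. by case: k => // k y0 _; rewrite exprAC y0 expr0n. Qed.

Lemma oppr_nilp y : y ^+ N.+1 = 0 -> (- y) ^+ N.+1 = 0.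
Proof. by move=> y0; rewrite exprNn y0 mulr0. Qed.

Lemma overgeoN y : y ^+ N.+1 = 0 -> overgeo N y * overgeo N (- y) = 1.
Proof.
move=> y0; have Ny0 := oppr_nilp y0.
have g := overgeo_mul y0; have gN := overgeo_mul Ny0.
have := sub1_unit_nilp y0; have := sub1_unit_nilp Ny0.
move: (overgeo N y) (overgeo N (- y)) g gN => a b g gN.
set u := \sum_(i < _) _; set v := \sum_(i < _) _ => hu hv.
have -> : a * b = ((1 - y) * v) * ((1 - - y) * u) * (a * b) by rewrite hv hu !mul1r.
transitivity (u * v * ((1 - y) * a) * ((1 - - y) * b)); first by ring.
rewrite g gN; transitivity (((1 - y) * v) * ((1 - - y) * u)); first by ring.
by rewrite hu hv mulr1.
Qed.

Lemma overgeo0 : overgeo N (0 : R) = 1.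
Proof.
rewrite /overgeo big_ord_recl expr0 mulr1n big1 ?addr0 // => i _.
by rewrite expr0n mul0rn.
Qed.

(** Put q = -x in [gauss_finite]: on the right every term with s > 0 has a factor q^(N+1) = 0, and
    the remaining product of the 1 - q^j is invertible, with an inverse built from geometric
    sums. *)
Lemma theta_overprodN x : x ^+ N.+1 = 0 -> theta N x * overprod N (- x) = 1.
Proof.
move=> x0; have Nx0 := oppr_nilp x0.
have /esym := gauss_finite (- x) N.
rewrite [X in X = _ -> _]big_ltn // [X in _ + X]big1_seq; last first.
  move=> s /andP[_]; rewrite mem_index_iota; case: s => // s _.
  by rewrite mulSn exprD Nx0 mul0r mulr0 !mul0r.
rewrite [\prod_(0 <= j < 0) _]big_geq // expr0 !mul1r addr0 => /esym.
have -> : 1 + (\sum_(1 <= k < N.+1) (-1) ^+ k * (- x) ^+ (k ^ 2)) *+ 2 = theta N x.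
  congr (1 + _ *+ 2); apply: eq_bigr => k _.
  rewrite (exprNn x) mulrA -exprD -signr_odd oddD -mulnn oddM.
  by case: (odd k); rewrite mul1r.
have -> : \prod_(1 <= j < N.+1) (1 + (- x) ^+ j) =
    \prod_(1 <= j < N.+1) (1 - (- x) ^+ j) * overprod N (- x).
  rewrite -big_split /=; apply: eq_big_nat => j /andP[j0 _].
  by rewrite overgeo_mul // expr_nilp.
have [z hz] : exists z, \prod_(1 <= j < N.+1) (1 - (- x) ^+ j) * z = 1.
  exists (\prod_(1 <= j < N.+1) \sum_(i < N.+1) ((- x) ^+ j) ^+ i).
  rewrite -big_split /= big_nat big1 // => j /andP[j0 _].
  by rewrite sub1_unit_nilp // expr_nilp.
move: hz; set D := \prod_(1 <= j < N.+1) _ => hz e.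
rewrite -[LHS]mulr1 -[X in _ * X]hz -hz -[in RHS]e; ring.
Qed.

(** Even j = 2 i up to N only reach i <= N / 2, but factors of index beyond N are [overgeo N 0] = 1,
    so the product may be extended to j <= 2 N. *)
Lemma even_overprod x : x ^+ N.+1 = 0 ->
  \prod_(1 <= j < N.+1 | ~~ odd j) overgeo N (x ^+ j) = overprod N (x ^+ 2).
Proof.
move=> x0; rewrite /overprod.
have H2 m : \prod_(1 <= j < m.*2.+1 | ~~ odd j) overgeo N (x ^+ j) =
   \prod_(1 <= j < m.+1) overgeo N ((x ^+ 2) ^+ j).
  elim: m => [|m IH]; first by rewrite !big_geq.
  rewrite doubleS [LHS]big_mkcond big_nat_recr // big_nat_recr // -big_mkcond /=.
  by rewrite IH /= odd_double /= mulr1 [RHS]big_nat_recr //= -exprM mul2n doubleS.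
have H3 k : \prod_(1 <= j < N.+1 | ~~ odd j) overgeo N (x ^+ j) =
    \prod_(1 <= j < (N + k).+1 | ~~ odd j) overgeo N (x ^+ j).
  elim: k => [|k ->]; first by rewrite addn0.
  rewrite addnS [LHS]big_mkcond [RHS]big_mkcond [RHS]big_nat_recr //=.
  case: odd => /=; rewrite ?mulr1 //.
  by rewrite -addSn addnC exprD x0 mulr0 overgeo0 mulr1.
by rewrite -H2 -addnn -H3.
Qed.

(** The odd factors at -x are inverse to those at x, and the even factors do not see the sign, so
    [theta_overprodN] can be solved for the odd part. *)
Lemma odd_overprod x : x ^+ N.+1 = 0 ->
  \prod_(1 <= j < N.+1 | odd j) overgeo N (x ^+ j) =
  theta N x * overprod N (x ^+ 2).
Proof.
move=> x0; have := theta_overprodN x0.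
rewrite /overprod (bigID odd) /= even_overprod ?oppr_nilp // sqrrN => h.
have ho : \prod_(1 <= j < N.+1 | odd j) overgeo N (x ^+ j) *
    \prod_(1 <= j < N.+1 | odd j) overgeo N ((- x) ^+ j) = 1.
  rewrite -big_split /= big1_seq // => j /andP[oj].
  rewrite mem_index_iota => /andP[j0 _].
  by rewrite (exprNn x) -signr_odd oj mulN1r overgeoN // expr_nilp.
rewrite -/(overprod N (x ^+ 2)) in h *.
rewrite -[LHS]mulr1 -[X in _ * X]h mulrCA; congr (_ * _).
by rewrite mulrA ho mul1r.
Qed.

(** With P = [overprod N], odd and even factors give (theta(x) P(x^2))^s P(x^2); the same splitting
    at x^2 gives P(x^2) = theta(x^2) P(x^4)^2. *)
Lemma colored_overprod (s : nat) x : x ^+ N.+1 = 0 ->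
  \prod_(1 <= j < N.+1) overgeo N (x ^+ j) ^+ ncolors s j =
  theta N x ^+ s * theta N (x ^+ 2) ^+ s.+1 * overprod N (x ^+ 4) ^+ (2 * s.+1).
Proof.
move=> x0; rewrite (bigID odd) /=.
rewrite [X in _ * X](eq_bigr (fun j => overgeo N (x ^+ j))); last first.
  by move=> j /negPf oj; rewrite /ncolors oj.
rewrite (eq_bigr (fun j => overgeo N (x ^+ j) ^+ s)); last first.
  by move=> j oj; rewrite /ncolors oj.
rewrite prodrXl odd_overprod // even_overprod //.
have x20 := expr_nilp x0 (isT : 0 < 2)%N.
have -> : overprod N (x ^+ 2) = theta N (x ^+ 2) * overprod N (x ^+ 4) ^+ 2.
  rewrite [LHS]/overprod (bigID odd) /= odd_overprod // even_overprod //.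
  by rewrite -exprM mulrA.
rewrite exprMn -mulrA -exprSr -mulrA; congr (_ * _).
by rewrite exprMn -exprM.
Qed.

End Nilpotent.

(** * The generating function of [abar] *)

Lemma abar_sum (s n : nat) :
  abar s n = (\sum_(f : {ffun part s n -> 'I_n.+1} | \sum_x f x * part_size x == n)
    2 ^ (\sum_x (0 < f x)))%N.
Proof.
rewrite /abar -sum1dep_card /is_colored_overpartition.
rewrite -(pair_big_dep (fun f : {ffun part s n -> 'I_n.+1} =>
    \sum_x f x * part_size x == n)%N
  (fun f (A : {set part s n}) => A \subset [set x | 0 < f x]%N) (fun _ _ => 1%N)) /=.
apply: eq_bigr => f _; rewrite sum1dep_card.
transitivity #|powerset [set x | 0 < f x]%N|.
  by apply: eq_card => A; rewrite !inE.
rewrite card_powerset; congr (2 ^ _)%N.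
by rewrite -sum1_card big_mkcond; apply: eq_bigr => x _; rewrite inE; case: ltnP.
Qed.

Lemma abar_coef (s n : nat) :
  (abar s n)%:R =
  (\prod_(1 <= j < n.+1) overgeo n ('X^j : {poly int}) ^+ ncolors s j)`_n.
Proof.
have -> : \prod_(1 <= j < n.+1) overgeo n ('X^j : {poly int}) ^+ ncolors s j =
    \prod_(x : part s n) overgeo n ('X^(part_size x)).
  rewrite big_add1 /= big_mkord.
  rewrite -(sig_big_dep xpredT (fun _ _ => true)
    (fun (j : 'I_n) (_ : 'I_(ncolors s j.+1)) => overgeo n ('X^(j.+1) : {poly int}))).
  by apply: eq_bigr => j _; rewrite prodr_const card_ord.
rewrite /overgeo bigA_distr_bigA /= coef_sum abar_sum big_mkcond natr_sum.
apply: eq_bigr => f _.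
have -> : \prod_x (('X^(part_size x) : {poly int}) ^+ f x *+ 2 ^ (0 < f x)) =
   'X^(\sum_x f x * part_size x) *+ 2 ^ (\sum_x (0 < f x)).
  rewrite prodrMn -expn_sum; congr (_ *+ _).
  rewrite -prodrXr; apply: eq_bigr => x _.
  by rewrite -exprM mulnC.
rewrite coefMn coefXn eq_sym; case: eqP => _; first by [].
by rewrite mul0rn.
Qed.

(** The quotient by X^(n+1) makes X nilpotent, so that the identities above apply there, and it
    still determines the coefficients up to n. *)
Lemma coef_in_qpoly (n i : nat) (u v : {poly int}) :
  in_qpoly 'X^(n.+1) u = in_qpoly 'X^(n.+1) v -> (i <= n)%N -> u`_i = v`_i.
Proof.
move=> /(congr1 val) /=; rewrite mk_monic_Xn /= -!Pdiv.RingMonic.take_poly_rmodp => h lein.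
by have := congr1 (fun w : {poly int} => w`_i) h; rewrite !coef_take_poly ltnS lein.
Qed.

Section Morphism.
Variables (R S : comNzRingType) (f : {rmorphism R -> S}) (n : nat).

Lemma rmorph_overgeo u : f (overgeo n u) = overgeo n (f u).
Proof. by rewrite rmorph_sum; apply: eq_bigr => i _; rewrite rmorphMn rmorphXn. Qed.

Lemma rmorph_overprod u : f (overprod n u) = overprod n (f u).
Proof.
by rewrite rmorph_prod; apply: eq_bigr => i _; rewrite rmorph_overgeo rmorphXn.
Qed.

Lemma rmorph_theta u : f (theta n u) = theta n (f u).
Proof.
rewrite rmorphD rmorphMn rmorph1 rmorph_sum; congr (1 + _ *+ 2).
by apply: eq_bigr => i _; rewrite rmorphXn.
Qed.

Lemma rmorph_colored_overprod (s : nat) x : f x ^+ n.+1 = 0 ->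
  f (\prod_(1 <= j < n.+1) overgeo n (x ^+ j) ^+ ncolors s j) =
  f (theta n x ^+ s * theta n (x ^+ 2) ^+ s.+1 * overprod n (x ^+ 4) ^+ (2 * s.+1)).
Proof.
move=> x0; rewrite !rmorphM !rmorphXn !rmorph_theta rmorph_overprod !rmorphXn.
rewrite -(colored_overprod s x0) rmorph_prod.
by apply: eq_bigr => j _; rewrite rmorphXn rmorph_overgeo rmorphXn.
Qed.

End Morphism.

Lemma abar_theta_coef (s n : nat) :
  (abar s n)%:R = (theta n ('X : {poly int}) ^+ s * theta n 'X^2 ^+ s.+1 *
    overprod n 'X^4 ^+ (2 * s.+1))`_n.
Proof.
rewrite abar_coef; apply: coef_in_qpoly (leqnn n).
apply: rmorph_colored_overprod; rewrite -rmorphXn; apply/val_inj.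
by rewrite /= mk_monic_Xn Pdiv.RingMonic.rmodpp // monicXn.
Qed.

(** * Dissection by exponents modulo 4 *)

(* In the usual notation, Ramanujan's psi at x^2. *)
Definition psi (R : comNzRingType) (L : nat) (x : R) : R :=
  \sum_(0 <= t < L) x ^+ (t * t.+1).

Lemma rmorph_psi (R S : comNzRingType) (f : {rmorphism R -> S}) n u :
  f (psi n u) = psi n (f u).
Proof. by rewrite rmorph_sum; apply: eq_bigr => t _; rewrite rmorphXn. Qed.

(** Even k = 2 j give x^(4 j^2), and odd k = 2 t + 1 give x times x^(4 t (t + 1)). With an odd
    cutoff 2 L + 1 both j and t run exactly up to L. *)
Lemma theta_dissect (R : comNzRingType) (L : nat) (x : R) :
  theta (2 * L).+1 x = theta L (x ^+ 4) + (x * psi L.+1 (x ^+ 4)) *+ 2.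
Proof.
rewrite /theta /psi -addrA -mulrnDl; congr (1 + _ *+ 2).
elim: L => [|L IH]; first by rewrite big_nat1 big_geq // big_nat1 add0r mulr1.
have -> : (2 * L.+1 = (2 * L).+2)%N by lia.
rewrite [LHS]big_nat_recr // [X in X + _ = _]big_nat_recr //= IH [in RHS]big_nat_recr //=.
rewrite [\sum_(0 <= t < L.+2) _]big_nat_recr //= mulrDr -!exprM -exprS.
have -> : ((2 * L).+2 ^ 2 = 4 * L.+1 ^ 2)%N by rewrite -!mulnn; lia.
have -> : ((2 * L).+3 ^ 2 = (4 * (L.+1 * L.+2)).+1)%N by rewrite -!mulnn; lia.
ring.
Qed.

Lemma coef_mulXn_comp_X4 (k M : nat) (h : {poly int}) :
  ('X^k * (h \Po 'X^4))`_(4 * M + 3) =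
  if (k <= 4 * M + 3)%N && (k %% 4 == 3)%N then h`_((4 * M + 3 - k) %/ 4) else 0.
Proof.
rewrite coefXnM ltnNge; case: leqP => //= lek.
rewrite coef_comp_poly_Xn //.
have -> : (4 %| 4 * M + 3 - k)%N = (k %% 4 == 3)%N by lia.
by [].
Qed.

(** Expanding both powers of theta, i and j count the factors from which the psi term is taken. This
    is the resulting cofactor of X^(i + 2 j), written in X for X^4, without the powers of 2 and the
    binomial coefficients. *)
Definition dissect_coef (s M i j : nat) : {poly int} :=
  theta (2 * M).+1 'X ^+ (s - i) * psi (2 * M).+2 'X ^+ i *
  (theta (2 * M).+1 'X^2 ^+ (s.+1 - j) * psi (2 * M).+2 'X^2 ^+ j) *
  overprod (4 * M + 3) 'X ^+ (2 * s.+1).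

Lemma monomial_collect (R : comNzRingType) (x y b c u v w : R) (i j k l : nat) :
  u * (x * b *+ 2) ^+ i *+ k * (v * (y * c *+ 2) ^+ j *+ l) * w =
  x ^+ i * y ^+ j * (u * b ^+ i * (v * c ^+ j) * w) *+ (2 ^ (i + j) * k * l).
Proof.
rewrite -(mulr_natr _ 2) -(mulr_natr (y * c)) -(mulr_natr _ k) -(mulr_natr _ l).
rewrite -[RHS]mulr_natr !natrM natrX !exprMn exprD; ring.
Qed.

Lemma abar_dissect (s M : nat) :
  (abar s (4 * M + 3))%:R =
  \sum_(i < s.+1) \sum_(j < s.+2)
    ('X^(i + 2 * j) * (dissect_coef s M i j \Po 'X^4))`_(4 * M + 3)
      *+ (2 ^ (i + j) * 'C(s, i) * 'C(s.+1, j)).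
Proof.
rewrite abar_theta_coef.
have -> : (4 * M + 3 = (2 * (2 * M).+1).+1)%N by lia.
rewrite (theta_dissect _ 'X) (theta_dissect _ 'X^2).
have -> : ((2 * (2 * M).+1).+1 = 4 * M + 3)%N by lia.
pose f : {rmorphism {poly int} -> {poly int}} := comp_poly 'X^4.
have fX k : f 'X^k = 'X^4 ^+ k by rewrite rmorphXn /= comp_polyX.
have ftheta (n : nat) u : f (theta n u) = theta n (f u) := rmorph_theta f n u.
have fpsi (n : nat) u : f (psi n u) = psi n (f u) := rmorph_psi f n u.
have fov (n : nat) u : f (overprod n u) = overprod n (f u) := rmorph_overprod f n u.
rewrite !exprDn mulr_suml mulr_suml coef_sum.
apply: eq_bigr => i _; rewrite mulr_sumr mulr_suml coef_sum.
apply: eq_bigr => j _.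
rewrite -coefMn; congr ((polyseq _)`__).
rewrite -[_ \Po _]/(f _) /dissect_coef !rmorphM !rmorphXn !ftheta !fpsi fov.
have -> : f 'X = 'X^4 by rewrite /= comp_polyX.
have -> : ('X^2 : {poly int}) ^+ 4 = 'X^4 ^+ 2 by rewrite exprAC.
move: fX ftheta fpsi fov; rewrite /f /= => fX _ _ _.
rewrite fX (exprD 'X) (exprM 'X 2).
exact: monomial_collect.
Qed.

(** * Reduction modulo 2 *)

(* As 4 M + 3 = (2 k + 1)^2 + 2 (2 l + 1)^2 means k (k + 1) + 2 l (l + 1) = M, this
   counts such representations; the bound on k and l is not restrictive. *)
Definition nrep (M : nat) : nat :=
  \sum_(0 <= k < (2 * M).+2) \sum_(0 <= l < (2 * M).+2)
     (k * k.+1 + 2 * (l * l.+1) == M).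

Section CharTwo.
Variables (R : comNzRingType) (char2 : 2 \in [pchar R]).

Lemma natmul_expr2_pchar2 (x : R) (n : nat) : (0 < n)%N -> x *+ 2 ^ n = 0.
Proof. by case: n => // n _; rewrite expnS mulrnA mulr2n addrr_pchar2 // mul0rn. Qed.

Lemma theta_pchar2 n (x : R) : theta n x = 1.
Proof. by rewrite /theta mulr2n addrr_pchar2 ?addr0. Qed.

Lemma overprod_pchar2 n (x : R) : overprod n x = 1.
Proof.
rewrite /overprod big1 // => j _; rewrite /overgeo big_ord_recl expr0 big1 ?addr0 //.
by move=> i _; rewrite natmul_expr2_pchar2.
Qed.

Lemma psi_sqr_pchar2 n (x : R) : psi n x ^+ 2 = psi n (x ^+ 2).
Proof.
rewrite -(pFrobenius_autE char2) /psi rmorph_sum; apply: eq_bigr => t _.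
by rewrite -[LHS]/(pFrobenius_aut char2 _) pFrobenius_autE exprAC.
Qed.

End CharTwo.

Lemma coef_psi_mul (R : comNzRingType) (M : nat) :
  (psi (2 * M).+2 ('X : {poly R}) * psi (2 * M).+2 'X^2)`_M = (nrep M)%:R.
Proof.
rewrite /psi mulr_suml coef_sum natr_sum; apply: eq_bigr => k _.
rewrite mulr_sumr coef_sum natr_sum; apply: eq_bigr => l _.
by rewrite -exprM -exprD coefXn eq_sym.
Qed.

Lemma pchar2_poly_F2 : 2 \in [pchar {poly 'F_2}].
Proof. by rewrite pchar_poly pchar_Fp. Qed.

(** Modulo 2 only the psi factors survive: (1, 1) leaves psi(X) psi(X^2) at once, and (3, 0) leaves
    psi(X)^3, where psi(X)^2 = psi(X^2) by Frobenius. *)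
Lemma dissect_coef_mod2 (s M i j : nat) : (i, j) \in [:: (1, 1); (3, 0)]%N ->
  ~~ odd (nrep M) -> (2 %| (dissect_coef s M i j)`_M)%Z.
Proof.
move=> ij evenr; pose f : {rmorphism {poly int} -> {poly 'F_2}} := map_poly intr.
have c2 := pchar2_poly_F2.
rewrite (dvdz_pcharf (pchar_Fp (isT : prime 2))).
rewrite -(coef_map (intr : {rmorphism int -> 'F_2})) -[map_poly _ _]/(f _).
rewrite !rmorphM !rmorphXn !rmorph_theta rmorph_overprod !rmorph_psi.
rewrite !theta_pchar2 // overprod_pchar2 // !expr1n !mul1r mulr1.
have -> : f 'X = 'X by rewrite /= map_polyX.
have -> : f 'X^2 = 'X^2 by rewrite /= map_polyXn.
have -> : psi (2 * M).+2 ('X : {poly 'F_2}) ^+ i * psi (2 * M).+2 'X^2 ^+ j =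
   psi (2 * M).+2 'X * psi (2 * M).+2 'X^2.
  move: ij; rewrite !inE => /orP[] /eqP[-> ->]; first by rewrite !expr1.
  by rewrite exprS psi_sqr_pchar2 // mulr1.
rewrite coef_psi_mul -(dvdn_pcharf (pchar_Fp (isT : prime 2))).
by rewrite dvdn2.
Qed.

(** The condition i + 2 j = 3 modulo 4 forces i to be odd, and if i + j < 4 only (1, 1) and (3, 0)
    remain. For these two, [dissect_coef_mod2] supplies the extra factor 2 in the last two
    hypotheses. *)
Lemma dvdn_abar (s M : nat) (D : nat) : ~~ odd (nrep M) ->
  (forall i j : nat, odd i -> 4 <= i + j -> D %| 2 ^ (i + j) * 'C(s, i) * 'C(s.+1, j))%N ->
  (D %| 2 ^ 2 * 'C(s, 1) * 'C(s.+1, 1) * 2)%N ->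
  (D %| 2 ^ 3 * 'C(s, 3) * 'C(s.+1, 0) * 2)%N ->
  (D %| abar s (4 * M + 3))%N.
Proof.
move=> evenr big D11 D30; rewrite -[X in is_true X]/(D%:Z %| (abar s (4 * M + 3))%:Z)%Z.
rewrite -[(abar _ _)%:Z]natz abar_dissect.
apply: rpred_sum => i _; apply: rpred_sum => j _.
rewrite coef_mulXn_comp_X4 -mulr_natr natz.
case: ifP => [/andP[_ ij3]|_]; last by rewrite mul0r dvdz0.
have oi : odd i by lia.
have [le4|lt4] := leqP 4 (i + j); first by apply: dvdz_mull; apply: big.
have ij : ((i : nat), (j : nat)) \in [:: (1, 1); (3, 0)]%N.
  by rewrite !inE !xpair_eqE; lia.
have -> : ((4 * M + 3 - (i + 2 * j)) %/ 4)%N = M.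
  by move: ij; rewrite !inE !xpair_eqE; lia.
have /dvdzP[c ->] := dissect_coef_mod2 s ij evenr.
rewrite -mulrA; apply: dvdz_mull; rewrite mulrC.
by move: ij; rewrite !inE => /orP[] /eqP[-> ->].
Qed.

(** * Counting with involutions *)

Section Involutions.
Local Open Scope nat_scope.
Variable T : eqType.
Implicit Types (S : seq T) (P Q : pred T) (f : T -> T).

Lemma odd_size_invol S f : uniq S ->
  (forall t, t \in S -> f t \in S /\ f (f t) = t) ->
  odd (size S) = odd (count (fun t => f t == t) S).
Proof.
have [n] := ubnP (size S); elim: n S => // n IH [|x S] //= ltSn /andP[xS uS] cl.
have [fxS ffx] := cl x (mem_head _ _).
have [fx|nfx] := eqVneq (f x) x.
  rewrite oddD /= -IH // => t tS.
  have [|ftS fft] := cl t; first by rewrite in_cons tS orbT.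
  split=> //; move: ftS; rewrite in_cons => /orP[/eqP ft|//].
  by move: xS; rewrite -fx -ft fft tS.
have {}fxS : f x \in S by move: fxS; rewrite in_cons (negPf nfx).
have pS := perm_to_rem fxS.
rewrite add0n (perm_size pS) (permP pS) /= negbK ffx eq_sym (negPf nfx) add0n.
apply: IH; first by move: ltSn; rewrite (perm_size pS) /= !ltnS; exact: ltnW.
  exact: rem_uniq.
move=> t; rewrite mem_rem_uniq // inE => /andP[/= ntfx tS].
have [|ftS fft] := cl t; first by rewrite in_cons tS orbT.
split=> //; rewrite mem_rem_uniq // inE; apply/andP; split.
  by apply/eqP => e; move: xS; rewrite -ffx -e fft tS.
move: ftS; rewrite in_cons => /orP[/eqP e|//].
by move: ntfx; rewrite -e fft eqxx.
Qed.

Lemma odd_count_invol S P f : uniq S ->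
  (forall t, t \in S -> P t -> [/\ f t \in S, P (f t) & f (f t) = t]) ->
  odd (count P S) = odd (count (fun t => P t && (f t == t)) S).
Proof.
move=> uS cl; rewrite -size_filter (odd_size_invol (f := f)) ?filter_uniq //.
  by rewrite count_filter; congr odd; apply: eq_count => t /=; rewrite andbC.
move=> t; rewrite mem_filter => /andP[Pt tS].
by have [ftS Pft fft] := cl t tS Pt; rewrite mem_filter Pft.
Qed.

Lemma even_count_invol S P f : uniq S ->
  (forall t, t \in S -> P t -> [/\ f t \in S, P (f t), f (f t) = t & f t != t]) ->
  ~~ odd (count P S).
Proof.
move=> uS cl; rewrite (odd_count_invol (f := f)) //; last first.
  by move=> t tS Pt; have [] := cl t tS Pt.
rewrite (eq_in_count (a2 := pred0)) ?count_pred0 // => t tS /=.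
by apply/negP => /andP[Pt ft]; have [_ _ _] := cl t tS Pt; rewrite ft.
Qed.

Lemma count_invol S P Q f : uniq S ->
  (forall t, t \in S -> [/\ f t \in S, f (f t) = t & Q (f t) = P t]) ->
  count P S = count Q S.
Proof.
move=> uS cl; have fS : perm_eq (map f S) S.
  apply: uniq_perm => //.
    rewrite map_inj_in_uniq // => t u tS uS' e.
    by have [_ <- _] := cl t tS; have [_ <- _] := cl u uS'; rewrite e.
  move=> t; apply/mapP/idP => [[u uS' ->]|tS]; first by have [] := cl u uS'.
  by exists (f t); have [] := cl t tS.
rewrite -[RHS](permP fS) count_map; apply: eq_in_count => t tS /=.
by have [_ _ /= ->] := cl t tS.
Qed.

Lemma count_split S P Q (P' : pred T) :
  (forall t, t \in S -> P t = Q t (+) P' t) ->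
  (forall t, t \in S -> ~~ (Q t && P' t)) ->
  count P S = count Q S + count P' S.
Proof.
move=> h1 h2; rewrite -(count_predUI Q) (eq_in_count (a2 := predU Q P')); last first.
  by move=> t tS /=; rewrite h1 //; have := h2 t tS; case: (Q t); case: (P' t).
rewrite [X in _ + X](eq_in_count (a2 := pred0)) ?count_pred0 ?addn0 //.
by move=> t tS /=; apply/negbTE/h2.
Qed.

End Involutions.

Lemma count_eq_bij (T U : eqType) (S : seq T) (V : seq U) (P : pred T) (Q : pred U)
    (f : T -> U) (g : U -> T) : uniq S -> uniq V ->
  (forall t, t \in S -> P t -> [/\ f t \in V, Q (f t) & g (f t) = t]) ->
  (forall u, u \in V -> Q u -> [/\ g u \in S, P (g u) & f (g u) = u]) ->
  count P S = count Q V.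
Proof.
move=> uS uV hf hg; rewrite -!size_filter -(size_map f).
apply/perm_size/uniq_perm; last 1 first.
- move=> u; rewrite mem_filter; apply/mapP/andP => [[t]|[Qu uu]].
    by rewrite mem_filter => /andP[Pt tS] ->; have [] := hf t tS Pt.
  by have [guS Pgu fgu] := hg u uu Qu; exists (g u); rewrite ?mem_filter ?Pgu.
- rewrite map_inj_in_uniq ?filter_uniq // => t t'; rewrite !mem_filter.
  move=> /andP[Pt tS] /andP[Pt' tS'] e.
  by have [_ _ <-] := hf t tS Pt; have [_ _ <-] := hf t' tS' Pt'; rewrite e.
- by rewrite filter_uniq.
Qed.

(** * Divisor counts *)

Section Divisors.
Local Open Scope nat_scope.

(** The map d -> n / d exchanges the divisors below and above the square root of n. *)
Lemma size_divisors_nonsquare n : 0 < n -> (forall d, d * d != n) ->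
  size (divisors n) = 2 * count (fun d => d * d < n) (divisors n).
Proof.
move=> n0 nsq; rewrite -(count_predC (fun d => d * d < n)) mul2n -addnn.
congr addn; apply/esym.
apply: (count_invol (f := fun d => n %/ d)); first exact: divisors_uniq.
move=> d; rewrite -dvdn_divisors // => dn.
have /dvdnP[e ne] := dn; have d0 := dvdn_gt0 n0 dn.
have nd : n %/ d = e by rewrite ne mulnK.
have e0 : 0 < e by move: n0; rewrite ne muln_gt0 => /andP[].
rewrite -dvdn_divisors // nd ne dvdn_mulr // mulKn //=; split=> //.
rewrite !ltn_mul2l !ltn_mul2r e0 d0 /= -leqNgt leq_eqVlt.
by have := nsq d; rewrite ne eqn_pmul2r // eq_sym => /negPf ->.
Qed.

Lemma size_divisors_coprime m n : coprime m n -> 0 < m -> 0 < n ->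
  size (divisors (m * n)) = size (divisors m) * size (divisors n).
Proof.
move=> co m0 n0; rewrite -(size_allpairs muln); apply/perm_size/uniq_perm.
- exact: divisors_uniq.
- apply: allpairs_uniq; try exact: divisors_uniq.
  move=> [a b] [c d] /allpairsP[[a1 b1] /= [am bn [-> ->]]].
  move=> /allpairsP[[c1 d1] /= [cm dn [-> ->]]] /= e.
  rewrite -!dvdn_divisors // in am bn cm dn.
  have g x y : x %| m -> y %| n -> gcdn (x * y) m = x.
    move=> xm yn; rewrite gcdnC Gauss_gcdl ?(gcdn_idPr xm) //.
    exact: coprime_dvdr yn co.
  have ac : a1 = c1 by rewrite -(g a1 b1) // e g.
  move: e; rewrite ac => /eqP; rewrite eqn_pmul2l ?(dvdn_gt0 m0 cm) // => /eqP ->.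
  by [].
move=> d; rewrite -dvdn_divisors ?muln_gt0 ?m0 //; apply/idP/allpairsP.
  move=> dmn; exists (gcdn d m, gcdn d n) => /=.
  rewrite -!dvdn_divisors // !dvdn_gcdr; split=> //.
  apply/eqP; rewrite eqn_dvd; apply/andP; split.
    rewrite muln_gcdl !muln_gcdr !dvdn_gcd dmn (mulnC m) !dvdn_mulr ?dvdn_mull //.
  rewrite Gauss_dvd ?dvdn_gcdl // (coprime_dvdl (dvdn_gcdr _ _)) //.
  by rewrite (coprime_dvdr (dvdn_gcdr _ _)).
move=> [[a b] /= [am bn ->]]; rewrite -!dvdn_divisors // in am bn.
exact: dvdn_mul.
Qed.

End Divisors.

(** * Obstructions modulo 4 and 8 *)

Lemma sum2sq_mod4 (a b n : int) : a * a + b * b <> 4 * n + 3.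
Proof.
move=> e.
have [c aE] : exists c, a = 2 * c \/ a = 2 * c + 1 by exists (a %/ 2)%Z; lia.
have [d bE] : exists d, b = 2 * d \/ b = 2 * d + 1 by exists (b %/ 2)%Z; lia.
move: aE bE => [] aE [] bE; move: e; rewrite aE bE !(mulrDl, mulrDr); lia.
Qed.

Lemma diff2sq_mod8 (w y n : int) : w * w - 2 * (y * y) <> 8 * n + 3.
Proof.
move=> e.
have [c wE] : exists c, w = 2 * c \/ w = 2 * c + 1 by exists (w %/ 2)%Z; lia.
have [d yE] : exists d, y = 2 * d \/ y = 2 * d + 1 by exists (y %/ 2)%Z; lia.
(* As c (c + 1) is even, w^2 = 8 k + 1 when w is odd. *)
have [k kE] : exists k, c * (c + 1) = 2 * k.
  have [c2 cE] : exists c2, c = 2 * c2 \/ c = 2 * c2 + 1 by exists (c %/ 2)%Z; lia.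
  by case: cE => ->; [exists (c2 * (2 * c2 + 1))|exists ((2 * c2 + 1) * (c2 + 1))]; ring.
move: wE yE => [] wE [] yE; move: e kE; rewrite wE yE !(mulrDl, mulrDr); lia.
Qed.

(** * The solutions of x^2 + 2 y z = 8 t + 3 *)

Definition zrange (n : nat) : seq int := [seq i%:Z - n%:Z | i <- iota 0 (2 * n).+1].

Lemma mem_zrange n (x : int) : (x \in zrange n) = (- n%:Z <= x <= n%:Z).
Proof.
apply/mapP/idP => [[i]|h]; first by rewrite mem_iota => hi ->; lia.
by exists (absz (x + n%:Z)); rewrite ?mem_iota; lia.
Qed.

Lemma uniq_zrange n : uniq (zrange n).
Proof. by rewrite map_inj_uniq ?iota_uniq // => i j; lia. Qed.

Section Triples.
Variable t : nat.
Let N : nat := (8 * t + 3)%N.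

Definition triples : seq (int * int * int) :=
  [seq u <- [seq (xy, z) | xy <- [seq (x, y) | x <- zrange N, y <- zrange N],
                           z <- zrange N]
   | let '(x, y, z) := u in [&& 0 < y, 0 < z & x * x + 2 * (y * z) == N%:Z]].

Lemma uniq_triples : uniq triples.
Proof.
apply/filter_uniq/allpairs_uniq; [|exact: uniq_zrange|by move=> [? ?] [? ?]].
by apply: allpairs_uniq; [exact: uniq_zrange|exact: uniq_zrange|move=> [? ?] [? ?]].
Qed.

Lemma mem_triples x y z :
  ((x, y, z) \in triples) = [&& 0 < y, 0 < z & x * x + 2 * (y * z) == N%:Z].
Proof.
rewrite mem_filter; case: and3P => // -[y0 z0 /eqP e].
have [hy hz] : y <= y * z /\ z <= y * z by nia.
have [hx hx'] : x <= x * x /\ - x <= x * x by nia.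
rewrite andTb; apply/allpairsP; exists (x, y, z); split=> //; last by rewrite mem_zrange /=; lia.
by apply/allpairsP; exists (x, y); split=> //; rewrite mem_zrange /=; lia.
Qed.

(** x^2 must be odd, hence 1 modulo 4, so 2 y z is 2 modulo 4 and z is odd. These parities exclude
    equality when solutions are later split by strict inequalities. *)
Lemma odd_triples x y z : (x, y, z) \in triples ->
  [/\ 0 < y, 0 < z, x * x + 2 * (y * z) = 8 * t%:Z + 3, exists a, x = 2 * a + 1 &
    exists c, z = 2 * c + 1].
Proof.
rewrite mem_triples => /and3P[y0 z0 /eqP e].
have {}e : x * x + 2 * (y * z) = 8 * t%:Z + 3 by rewrite e /N; lia.
have [a xE] : exists a, x = 2 * a \/ x = 2 * a + 1 by exists (x %/ 2)%Z; lia.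
have [c zE] : exists c, z = 2 * c \/ z = 2 * c + 1 by exists (z %/ 2)%Z; lia.
have {}xE : x = 2 * a + 1.
  case: xE => // xE; have : 2 * (2 * (a * a) + y * z) = 8 * t%:Z + 3.
    by rewrite -e xE; ring.
  by lia.
have {}zE : z = 2 * c + 1.
  case: zE => // zE; have : 4 * (a * a + a + y * c) + 1 = 8 * t%:Z + 3.
    by rewrite -e xE zE; ring.
  by lia.
by split=> //; [exists a | exists c].
Qed.

Lemma triples_eq x y z x' y' z' : (x, y, z) \in triples ->
  0 < y' -> 0 < z' -> x' * x' + 2 * (y' * z') = x * x + 2 * (y * z) ->
  (x', y', z') \in triples.
Proof. by rewrite !mem_triples => /and3P[_ _ e] -> -> ->; rewrite e. Qed.

Local Notation cnt P :=
  (count (fun u : int * int * int => let '(x, y, z) := u in P x y z) triples).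

Lemma cnt_swap : odd (cnt (fun x y z => 0 < x)) =
  odd (cnt (fun x y z => (0 < x) && (y == z))).
Proof.
pose f (u : int * int * int) := let '(x, y, z) := u in (x, z, y).
rewrite (odd_count_invol (f := f) uniq_triples) => [|[[x y] z] xyz /= x0].
  congr odd; apply: eq_count => -[[x y] z] /=.
  by rewrite !xpair_eqE eqxx /=; case: (0 < x) => //=; lia.
have [y0 z0 _ _ _] := odd_triples xyz.
by split=> //; apply: (triples_eq xyz) => //; ring.
Qed.

(** The condition 2 x + 2 y < z is what keeps the third coordinate of the image under f positive. *)
Lemma cnt_divisor_pairs : odd (cnt (fun x y z => 2 * x + 2 * y < z)) =
  odd (cnt (fun x y z => x == - y)).
Proof.
pose f (u : int * int * int) :=
  let '(x, y, z) := u in (- (x + 2 * y), y, z - 2 * x - 2 * y).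
rewrite (odd_count_invol (f := f) uniq_triples) => [|[[x y] z] xyz /= xz].
  congr odd; apply: eq_in_count => -[[x y] z] /= /odd_triples[y0 z0 _ _ _].
  by rewrite !xpair_eqE; lia.
have [y0 z0 _ _ _] := odd_triples xyz.
split; [apply: (triples_eq xyz); [lia|lia|ring]|lia|].
by congr (_, _, _); ring.
Qed.

(** x is odd, so never 0; negating x turns the half with x < 0 into the second summand. *)
Lemma cnt_sign : cnt (fun x y z => 2 * x + 2 * y < z) =
  addn (cnt (fun x y z => (0 < x) && (2 * x + 2 * y < z)))
       (cnt (fun x y z => (0 < x) && (2 * y < z + 2 * x))).
Proof.
rewrite (count_split (Q := fun u => let '(x, y, z) := u in (0 < x) && (2 * x + 2 * y < z))
  (P' := fun u => let '(x, y, z) := u in (x < 0) && (2 * x + 2 * y < z))); first 1 last.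
- by move=> [[x y] z] /odd_triples[_ _ _ [a ->] _]; case: (ltP 0); case: ltP => //=; lia.
- by move=> [[x y] z] _; lia.
congr addn.
pose f (u : int * int * int) := let '(x, y, z) := u in (- x, y, z).
apply: (count_invol (f := f) uniq_triples) => -[[x y] z] xyz /=.
have [y0 z0 _ _ _] := odd_triples xyz.
split; [by apply: (triples_eq xyz) => //; ring | by rewrite opprK | by lia].
Qed.

Lemma cnt_compare : cnt (fun x y z => 0 < x) =
  addn (cnt (fun x y z => (0 < x) && (2 * y < z + 2 * x)))
       (cnt (fun x y z => (0 < x) && (z + 2 * x < 2 * y))).
Proof.
apply: count_split => -[[x y] z]; last by lia.
by move=> /odd_triples[_ _ _ _ [c ->]]; lia.
Qed.

(** Exchange y and z, then cut by the sign of the odd number 2 x + 2 y - z. *)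
Lemma cnt_compare_swap : cnt (fun x y z => (0 < x) && (z + 2 * x < 2 * y)) =
  addn (cnt (fun x y z => (0 < x) && (2 * x + 2 * y < z)))
       (cnt (fun x y z => [&& 0 < x, y + 2 * x < 2 * z & z < 2 * x + 2 * y])).
Proof.
transitivity (cnt (fun x y z => (0 < x) && (y + 2 * x < 2 * z))).
  pose f (u : int * int * int) := let '(x, y, z) := u in (x, z, y).
  apply: (count_invol (f := f) uniq_triples) => -[[x y] z] xyz /=.
  have [y0 z0 _ _ _] := odd_triples xyz.
  by split=> //; apply: (triples_eq xyz) => //; ring.
apply: count_split => -[[x y] z]; last by lia.
by move=> /odd_triples[y0 _ _ _ [c ->]]; lia.
Qed.

(** As x is odd, 3 x + 2 y - 2 z is not 0, and each of its signs gives a class with an involution. A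
    fixed point would make N a sum of two squares, respectively of the form w^2 - 2 y^2, against N =
    3 modulo 8. *)
Lemma cnt_middle_even :
  ~~ odd (cnt (fun x y z => [&& 0 < x, y + 2 * x < 2 * z & z < 2 * x + 2 * y])).
Proof.
rewrite (count_split
  (Q := fun u => let '(x, y, z) := u in
    [&& 0 < x, y + 2 * x < 2 * z, z < 2 * x + 2 * y & 2 * z < 3 * x + 2 * y])
  (P' := fun u => let '(x, y, z) := u in
    [&& 0 < x, z < 2 * x + 2 * y & 3 * x + 2 * y < 2 * z])); first 1 last.
- by move=> [[x y] z] /odd_triples[y0 z0 _ [a ->] _]; lia.
- by move=> [[x y] z] _; lia.
rewrite oddD negb_add; apply/eqP; transitivity false; last apply/esym; apply/negbTE.
  (* In terms of s = x + y, r = z - x and w = z - x - y the equation is s^2 + r^2 - w^2 = N, and f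
     negates w. *)
  pose f (u : int * int * int) := let '(x, y, z) := u in
    (3 * x + 2 * y - 2 * z, 2 * z - 2 * x - y, 2 * x + 2 * y - z).
  apply: (even_count_invol (f := f) uniq_triples) => -[[x y] z] xyz /= xz.
  have [y0 z0 e _ _] := odd_triples xyz.
  split; [apply: (triples_eq xyz); [lia|lia|ring]|lia|by congr (_, _, _); ring|].
  rewrite !xpair_eqE; apply/negP => h; have zE : z = x + y by lia.
  apply: (@sum2sq_mod4 (x + y) y (2 * t%:Z)); rewrite mulrA -e zE; ring.
(* In terms of w = x + 2 y and v = 2 x + 2 y - z the equation is w^2 - 2 y v = N,
   and f exchanges y and v. *)
pose f (u : int * int * int) := let '(x, y, z) := u in
  (x + 2 * y - 2 * (2 * x + 2 * y - z), 2 * x + 2 * y - z,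
   2 * (x + 2 * y) - 2 * (2 * x + 2 * y - z) - y).
apply: (even_count_invol (f := f) uniq_triples) => -[[x y] z] xyz /= xz.
have [y0 z0 e _ _] := odd_triples xyz.
split; [apply: (triples_eq xyz); [lia|lia|ring]|lia|by congr (_, _, _); ring|].
rewrite !xpair_eqE; apply/negP => h; have zE : z = 2 * x + y by lia.
by apply: (@diff2sq_mod8 (x + 2 * y) y t%:Z); rewrite -e zE; ring.
Qed.

Lemma cnt_nrep : cnt (fun x y z => (0 < x) && (y == z)) = nrep (2 * t).
Proof.
pose L := (2 * (2 * t)).+2.
pose V := [seq (k, l) | k <- index_iota 0 L, l <- index_iota 0 L].
pose Q (kl : nat * nat) := (kl.1 * kl.1.+1 + 2 * (kl.2 * kl.2.+1) == 2 * t)%N.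
transitivity (count Q V); last first.
  rewrite -sum1_count big_mkcond big_allpairs_dep.
  apply: eq_bigr => k _; apply: eq_bigr => l _.
  by rewrite /Q /=; case: eqP.
pose f (u : int * int * int) := let '(x, y, z) := u in ((absz x)./2, (absz y)./2).
pose g (kl : nat * nat) : int * int * int :=
  ((2 * kl.1).+1%:Z, (2 * kl.2).+1%:Z, (2 * kl.2).+1%:Z).
apply: (count_eq_bij (f := f) (g := g) uniq_triples).
- by apply: allpairs_uniq; rewrite ?iota_uniq // => -[? ?] [? ?].
- move=> [[x y] z] xyz /= /andP[x0 /eqP yz].
  have [y0 z0 e [a xE] [c zE]] := odd_triples xyz.
  have [k kE] : exists k : nat, x = (2 * k).+1%:Z by exists (absz a); lia.
  have [l lE] : exists l : nat, z = (2 * l).+1%:Z by exists (absz c); lia.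
  have e' : (k * k.+1 + 2 * (l * l.+1) = 2 * t)%N.
    by move: e; rewrite yz kE lE; nia.
  rewrite /f yz kE lE; have -> : ((absz (2 * k).+1%:Z)./2 = k)%N by lia.
  have -> : ((absz (2 * l).+1%:Z)./2 = l)%N by lia.
  split=> //; last by rewrite /Q /= e'.
  have := leq_pmulr k (ltn0Sn k); have := leq_pmulr l (ltn0Sn l); rewrite -/L => hl hk.
  by apply/allpairsP; exists (k, l); rewrite /= !mem_index_iota /L; split=> //; lia.
- move=> [k l] _ /eqP /= e; rewrite /g /f /=; split; last by congr (_, _); lia.
  + by rewrite mem_triples /N; apply/and3P; split=> //; nia.
  by rewrite eqxx.
Qed.

(** At x = - y the equation reads y (y + 2 z) = N, so d = y is the smaller of two complementary
    divisors; both are odd, so their difference 2 z may be any that occurs. *)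
Lemma cnt_divisors :
  cnt (fun x y z => x == - y) = count (fun d => d * d < N)%N (divisors N).
Proof.
have N0 : (0 < N)%N by rewrite /N; lia.
pose f (u : int * int * int) := let '(x, y, z) := u in absz y.
pose g (d : nat) : int * int * int := (- d%:Z, d%:Z, ((N %/ d)%N - d)./2%:Z).
apply: (count_eq_bij (f := f) (g := g) uniq_triples); first exact: divisors_uniq.
  move=> [[x y] z] xyz /= /eqP xE.
  have [y0 z0 e _ _] := odd_triples xyz.
  have [d dE] : exists d : nat, y = d%:Z by exists (absz y); lia.
  have [k kE] : exists k : nat, z = k%:Z by exists (absz z); lia.
  have NE : N = (d * (d + 2 * k))%N by rewrite /N; move: e; rewrite xE dE kE; nia.
  rewrite /f /g dE absz_nat -dvdn_divisors // NE dvdn_mulr // mulKn; last by lia.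
  split=> //; first by nia.
  by rewrite xE dE kE; congr (_, _, _); lia.
move=> d; rewrite -dvdn_divisors // => /dvdnP[e NE] dd.
have d0 : (0 < d)%N by move: NE; case: d {dd} => //; rewrite /N; lia.
have lt : (d < e)%N by move: dd; rewrite NE ltn_mul2r => /andP[].
have oe : odd (e * d) by rewrite -NE /N; lia.
have [k kE] : exists k, e = (d + 2 * k)%N.
  by exists ((e - d)./2)%N; move: oe; rewrite oddM; lia.
rewrite /g /f NE mulnK // kE; have -> : ((d + 2 * k - d)./2 = k)%N by lia.
rewrite mem_triples NE kE; split=> //.
by apply/and3P; split; nia.
Qed.

(** Let A, B, C count the triples with x > 0 and, respectively, 2 y < z + 2 x, 2 x + 2 y < z, and
    the condition of [cnt_middle_even]. The triples with x > 0 number A + B + C, those with 2 x + 2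
    y < z number A + B, and C is even. *)
Lemma odd_nrep : odd (nrep (2 * t)) = odd (count (fun d => d * d < N)%N (divisors N)).
Proof.
rewrite -cnt_nrep -cnt_divisors -cnt_swap -cnt_divisor_pairs.
rewrite cnt_compare cnt_compare_swap cnt_sign addnA oddD (negPf cnt_middle_even) addbF.
by rewrite addnC.
Qed.

End Triples.

(** * The parity of [nrep] *)

Lemma nrep_even (p k m M : nat) : prime p -> ~~ (p %| m)%N -> (m = 3 %[mod 4])%N ->
  (4 * M + 3 = p ^ (2 * k).+1 * m)%N -> ~~ odd (nrep M).
Proof.
(* k (k + 1) + 2 l (l + 1) is even, so an odd M has no representation. *)
move=> pp pm m3 NE; have [oM|/even_halfK ME] := boolP (odd M).
  rewrite /nrep big1 // => i _; rewrite big1 // => l _; apply/eqP; rewrite eqb0.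
  apply/eqP => h; move: oM; rewrite -h oddD !oddM /=.
  by case: (odd i).
have [t tE] : exists t, M = (2 * t)%N by exists (M./2); lia.
have NE' : (8 * t + 3 = p ^ (2 * k).+1 * m)%N by rewrite -NE tE; lia.
have m0 : (0 < m)%N by case: m m3 {pm NE NE'}.
have pk0 : (0 < p ^ (2 * k).+1)%N by rewrite expn_gt0 prime_gt0.
(* None of the three numbers is a square: m and 8 t + 3 are 3 modulo 4, and p has an odd
   exponent. *)
have m_nsq d : (d * d != m)%N.
  by apply/eqP => e; have := @sum2sq_mod4 d%:Z 0 (m %/ 4)%N%:Z; nia.
have pk_nsq d : (d * d != p ^ (2 * k).+1)%N.
  apply/eqP => e; have := congr1 (logn p) e.
  have d0 : (0 < d)%N by move: e pk0; case: d => // <-.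
  by rewrite pfactorK // lognM //; lia.
have N_nsq d : (d * d != 8 * t + 3)%N.
  by apply/eqP => e; have := @sum2sq_mod4 d%:Z 0 (2 * t)%N%:Z; nia.
have N0 : (0 < 8 * t + 3)%N by lia.
(* Twice the count sought is (2 a) (2 b), with a and b the counts for the two coprime factors, so
   the count is 2 a b. *)
rewrite tE odd_nrep; have := size_divisors_nonsquare N0 N_nsq.
rewrite {1}NE' size_divisors_coprime //; last by rewrite coprimeXl // prime_coprime.
rewrite !size_divisors_nonsquare // -mulnA => /eqP; rewrite eqn_pmul2l // => /eqP <-.
by rewrite mulnCA oddM.
Qed.

End Overpartitions.

(** * The congruences *)

Lemma abar_progression (p s k n D : nat) :
  prime p -> (p = 1 %[mod 4]) -> ~~ (p %| 4 * n + 3) ->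
  (forall i j, odd i -> 4 <= i + j -> D %| 2 ^ (i + j) * 'C(s, i) * 'C(s.+1, j)) ->
  (D %| 2 ^ 2 * 'C(s, 1) * 'C(s.+1, 1) * 2) ->
  (D %| 2 ^ 3 * 'C(s, 3) * 'C(s.+1, 0) * 2) ->
  (abar s (4 * p ^ (2 * k + 1) * n + 3 * p ^ (2 * k + 1)) = 0 %[mod D]).
Proof.
move=> pp p1 pn big D11 D30.
have -> : (4 * p ^ (2 * k + 1) * n + 3 * p ^ (2 * k + 1) =
  p ^ (2 * k).+1 * (4 * n + 3)) by rewrite addn1; lia.
have [M ME] : exists M, (p ^ (2 * k).+1 * (4 * n + 3) = 4 * M + 3).
  exists (p ^ (2 * k).+1 * (4 * n + 3) %/ 4).
  have : (p ^ (2 * k).+1 * (4 * n + 3) = 3 %[mod 4]).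
    by rewrite -modnMml -modnXm p1 modnXm exp1n modnMml mul1n mulnC modnMDl.
  lia.
have n3 : (4 * n + 3 = 3 %[mod 4]) by rewrite mulnC modnMDl.
rewrite ME mod0n; apply/eqP; apply: dvdn_abar => //.
exact: nrep_even pp pn n3 (esym ME).
Qed.

(** i C(n, i) = n C(n - 1, i - 1), and an odd i is coprime to 2^m. *)
Lemma dvdn_bin_odd (m a i : nat) : odd i -> (2 ^ m %| 'C(2 ^ m * a, i)).
Proof.
case: i => // i oi; rewrite -(@Gauss_dvdr _ i.+1) -?mul_bin_diag.
  by rewrite -mulnA dvdn_mulr.
by rewrite coprimeXl // coprime2n.
Qed.

Theorem theorem1p8 (p m alpha beta : nat)
    (p_prime : prime p) (p_mod4 : p = 1 %[mod 4])
    (m_ge1 : 1 <= m) (alpha_ge1 : 1 <= alpha) (beta_ge1 : 1 <= beta)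
    (alpha_odd : ~~ (2 %| alpha)) :
  (abar (2 ^ m * alpha) (3 * p) = 0 %[mod 2] ->
   forall n k : nat, ~~ (p %| 4 * n + 3) ->
     abar (2 ^ m * alpha) (4 * p ^ (2 * k + 1) * n + 3 * p ^ (2 * k + 1))
       = 0 %[mod 2 ^ (m + 3)])
  /\
  (abar (2 * beta + 1) (3 * p) = 0 %[mod 2] ->
   forall n k : nat, ~~ (p %| 4 * n + 3) ->
     abar (2 * beta + 1) (4 * p ^ (2 * k + 1) * n + 3 * p ^ (2 * k + 1))
       = 0 %[mod 16]).
Proof.
split=> _ n k pn; apply: abar_progression => //.
(* 2^(i + j) gives 2^3, and the binomial coefficient with odd i gives 2^m. *)
- move=> i j oi ij; rewrite dvdn_mulr // addnC expnD dvdn_mul ?dvdn_bin_odd //.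
  by rewrite dvdn_exp2l //; lia.
- rewrite addnC expnD bin1
    (_ : 2 ^ 2 * _ * _ * 2 = 2 ^ 3 * 2 ^ m * (alpha * 'C((2 ^ m * alpha).+1, 1))).
    exact: dvdn_mulr.
  by rewrite -[2 ^ 3]/(2 ^ 2 * 2) !mulnA; lia.
- by rewrite addnC expnD dvdn_mulr // dvdn_mulr // dvdn_mul // dvdn_bin_odd.
- by move=> i j _ ij; rewrite -mulnA dvdn_mulr // (@dvdn_exp2l 2 4).
(* With s = 2 beta + 1, the factor s + 1 = 2 (beta + 1) supplies the missing 2. *)
- rewrite !bin1 (_ : _ * 2 = 16 * ((2 * beta + 1) * (beta + 1))) ?dvdn_mulr //.
  by rewrite -[2 ^ 2]/4; nia.
- by rewrite bin0 muln1 mulnAC dvdn_mulr.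
Qed.
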